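(* Let $n,k,\ell$ be integers with $0<k<n$ and $1<\ell$, and let $x^0\in\mathbb{Z}^n$ with $x^0_1\le\dots\le x^0_n$. Let $(x^j)_{j\ge 0}$ be the GM-$(n,k,\ell)$-sequence starting at $x^0$, and let $N=N(n,k,\ell,x^0)\ge 0$ be the integer such that, for all $j\ge 0$, both $m(x^j)\ge n-k$ and $\mathrm{range}(x^j)\le \ell$ hold if and only if $j\ge N$. Put $p=\ell n/\gcd(n,k)=\ell\,\mathrm{lcm}(n,k)/k$ and $\delta=pk/n$. Then for every $i\in[n]$ and every $j\ge N$ we have $x_i^{j}-x_i^{j+p}=\delta$, i.e. after every $p$ consecutive steps all entries are reduced by the same value $\delta$.
   Context: Notation: $[n]=\{1,\dots,n\}$. For an integer vector $x=(x_1,\dots,x_n)$ with $x_1\le\dots\le x_n$, let $M(x)$ be the set of indices $i\in[n]$ such that $x_i$ is a multiple of $\ell$, $m(x)=|M(x)|$, and $\mathrm{range}(x)=x_n-x_1$. The set $P(x)$ of bears (always of size $n-k$) is defined as follows. If $m(x)\ge n-k$: order the indices in $M(x)$ by increasing value $x_i$, and among indices with equal values by decreasing index $i$ (tie-breaking rule: prefer the rightmost), and let $P(x)$ be the first $n-k$ of them. If $m(x)<n-k$: $P(x)$ consists of all of $M(x)$ together with the $n-k-m(x)$ indices of $[n]\setminus M(x)$ with largest index (i.e. the largest entries). The remaining $k$ indices are bulls. The GM-$(n,k,\ell)$-move $x\to x'$ is given by $x'_i=x_i$ for $i\in P(x)$ and $x'_i=x_i-1$ for the $k$ bulls; it preserves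 the nondecreasing order of entries. The GM-$(n,k,\ell)$-sequence from $x^0$ is $x^0\to x^1\to x^2\to\cdots$ where $x^{j+1}$ is the GM-move of $x^j$. The existence of $N$ as described (with both conditions holding exactly for $j\ge N$) is part of the setting of the paper. *)

(* Defs.v *)
From mathcomp Require Import all_boot all_order all_algebra.

Set Implicit Arguments.
Unset Strict Implicit.
Unset Printing Implicit Defensive.

Import Order.TTheory GRing.Theory Num.Theory.

Local Open Scope ring_scope.

(* The entry x_i, 1 <= i <= n, is [tnth x] at the ordinal of value i - 1. *)

Definition mult_set (n l : nat) (x : n.-tuple int) : {set 'I_n} :=
  [set i | (l%:Z %| tnth x i)%Z].

Definition range (n : nat) (x : n.-tuple int) : int := x`_n.-1 - x`_0.

Definition bear_order (n : nat) (x : n.-tuple int) : rel 'I_n :=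
  fun i j => (tnth x i < tnth x j) || ((tnth x i == tnth x j) && (j <= i)%N).

(* [enum] lists a subset of 'I_n by increasing index, so [rev (enum _)] lists
   it from the largest index down. *)
Definition bears (n k l : nat) (x : n.-tuple int) : {set 'I_n} :=
  let M := mult_set l x in
  if (n - k <= #|M|)%N
  then [set i in take (n - k) (sort (bear_order x) (enum M))]
  else M :|: [set i in take (n - k - #|M|) (rev (enum (~: M)))].

Definition GM_move (n k l : nat) (x : n.-tuple int) : n.-tuple int :=
  [tuple if i \in bears k l x then tnth x i else tnth x i - 1 | i < n].

Definition GM_seq (n k l : nat) (x0 : n.-tuple int) (j : nat) : n.-tuple int :=
  iter j (@GM_move n k l) x0.

Definition period (n k l : nat) : nat := ((l * n) %/ gcdn n k)%N.

Definition drop_value (n k l : nat) : nat := ((period n k l * k) %/ n)%N.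

Lemma period_exact (n k l : nat) : (gcdn n k %| l * n)%N.
Proof. by rewrite dvdn_mull ?dvdn_gcdl. Qed.

Lemma drop_value_exact (n k l : nat) : (n %| period n k l * k)%N.
Proof.
have -> : (period n k l * k = l * n * (k %/ gcdn n k))%N.
  by rewrite /period muln_divA ?dvdn_gcdr // divn_mulAC ?period_exact.
by rewrite dvdn_mulr ?dvdn_mull.
Qed.

(* Main.v *)
(* Extend the entries to all integers by x_{i+n} = x_i + l. From step N on, the
   extended sequence is nondecreasing; let b_t be the last index with value
   <= 0 at time t. Up to multiples of n, the bears are the n-k indices ending
   at b_t, all of value 0, and the bulls are b_t+1, ..., b_t+k. An index of
   this bull window is decreased at every step until b reaches it, so it is
   reached after exactly as many steps as its current value. The value at
   b_t+k is at most l, and b_t+k+1 has value l but rests for one step, hence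
   b_{t+l} = b_t + k. The pointer path b determines the state, so the state at
   time t+l is the state at time t shifted by k indices. Iterating n/gcd(n,k)
   times shifts by a multiple of n, that is, subtracts a constant. *)
Require Import Defs.
From mathcomp Require Import all_boot all_order all_algebra.
From mathcomp Require Import zify.

Set Implicit Arguments.
Unset Strict Implicit.
Unset Printing Implicit Defensive.

Import Order.TTheory GRing.Theory Num.Theory.

Local Open Scope ring_scope.

(** * Abstract sliding-window dynamics and their period *)

(* The GM dynamics in the coordinates of the extended sequence: [Y t i] is the
   entry at index i and time t, and [b t] the last index of nonpositive value. *)
Record sliding_window (n k l : nat) (Y : nat -> int -> int) (b : nat -> int) :
  Prop := SlidingWindow {
  sw_shift : forall t i, Y t (i + n%:Z) = Y t i + l%:Z;
  sw_le0 : forall t i, (Y t i <= 0) = (i <= b t);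
  sw_zero : forall t i, b t + k%:Z - n%:Z < i <= b t -> Y t i = 0;
  sw_bull : forall t i, b t < i <= b t + k%:Z -> Y t.+1 i = Y t i - 1;
  sw_bear : forall t i, b t + k%:Z < i <= b t + n%:Z -> Y t.+1 i = Y t i }.

Lemma shift_mul (n l : nat) (f : int -> int) (q i : int) :
  (forall i, f (i + n%:Z) = f i + l%:Z) -> f (i + q * n%:Z) = f i + q * l%:Z.
Proof.
move=> fD.
have posD (m : nat) j : f (j + m%:Z * n%:Z) = f j + m%:Z * l%:Z.
  elim: m => [|m IHm]; first by rewrite !mul0r !addr0.
  by rewrite -addn1 PoszD !mulrDl !mul1r !addrA fD IHm.
case: (intP q) => [|m|m]; first by rewrite !mul0r !addr0.
  exact: posD.
by rewrite -[in RHS](subrK (m.+1%:Z * n%:Z) i) posD !mulNr addrK.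
Qed.

Lemma window_rep (n : nat) (a i : int) : (0 < n)%N ->
  exists q j : int, i = j + q * n%:Z /\ a < j <= a + n%:Z.
Proof.
move=> n_gt0; exists ((i - a - 1) %/ n%:Z)%Z, (a + 1 + ((i - a - 1) %% n%:Z)%Z).
have nz : n%:Z != 0 by lia.
have := divz_eq (i - a - 1) n%:Z.
have := modz_ge0 (i - a - 1) nz; have := @ltz_pmod (i - a - 1) n%:Z n_gt0.
by move: (_ %% _)%Z (_ * _) => r Q; lia.
Qed.

Section Sliding.

Context (n k l : nat) (Y : nat -> int -> int) (b : nat -> int).
Hypotheses (hk : (0 < k < n)%N) (hl : (0 < l)%N).
Hypothesis (hY : sliding_window n k l Y b).

Let Yq t q i : Y t (i + q * n%:Z) = Y t i + q * l%:Z.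
Proof. exact: shift_mul (sw_shift hY t). Qed.

Let Ystep t i : Y t i - 1 <= Y t.+1 i <= Y t i.
Proof.
have n_gt0 : (0 < n)%N by lia.
have [q [j [-> jb]]] := window_rep (b t) i n_gt0; rewrite !Yq.
have [jk|kj] := lerP j (b t + k%:Z).
  by rewrite (sw_bull hY) //; lia.
by rewrite (sw_bear hY) //; lia.
Qed.

Let b_step t : b t <= b t.+1.
Proof.
rewrite -(sw_le0 hY); have := sw_le0 hY t (b t).
by have := Ystep t (b t); lia.
Qed.

Let b_mono t s : b t <= b (t + s)%N.
Proof. by elim: s => [|s IHs]; rewrite ?addn0 // addnS (le_trans IHs). Qed.

Lemma sliding_hit t s j : b t < j <= b t + k%:Z ->
  (j <= b (t + s)%N) = (Y t j <= s%:Z).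
Proof.
(* The dichotomy is inductive: [b] is nondecreasing, so an index not yet reached is still in the
   bull window and loses exactly 1. *)
move=> jb; suff: (j <= b (t + s)%N /\ Y t j <= s%:Z) \/
                 (b (t + s)%N < j /\ Y (t + s)%N j = Y t j - s%:Z).
  by have := sw_le0 hY (t + s)%N j; lia.
elim: s => [|s IHs]; first by rewrite addn0; lia.
rewrite addnS; have := b_step (t + s); have := b_mono t s.
have := @sw_bull _ _ _ _ _ hY (t + s)%N j.
have := sw_le0 hY (t + s).+1 j; case: IHs => [|[sj Ysj]]; first by lia.
by move=> le0 bull bm bs; have := bull; rewrite Ysj; lia.
Qed.

Lemma sliding_pointer t : b (t + l)%N = b t + k%:Z.
Proof.
apply/le_anti/andP; split; last first.
  rewrite sliding_hit; last by lia.
  have := sw_le0 hY t (b t + k%:Z - n%:Z); have := sw_shift hY t (b t + k%:Z - n%:Z).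
  by rewrite subrK; lia.
(* The first index beyond the bulls is one period above an index of value 0, and it rests in this
   step. *)
have Yl : Y t.+1 (b t + k%:Z + 1) = l%:Z.
  rewrite (sw_bear hY); last by lia.
  have := sw_shift hY t (b t + k%:Z + 1 - n%:Z); rewrite subrK => ->.
  by rewrite (sw_zero hY); lia.
have Ylow s : l%:Z - s%:Z <= Y (t.+1 + s)%N (b t + k%:Z + 1).
  elim: s => [|s IHs]; first by rewrite addn0 Yl; lia.
  by rewrite addnS; have := Ystep (t.+1 + s) (b t + k%:Z + 1); lia.
(* At time [t + l] only [l - 1] steps have followed the rest, so the value is still at least 1. *)
have := sw_le0 hY (t + l) (b t + k%:Z + 1); have := Ylow l.-1.
by rewrite addSnnS prednK //; lia.
Qed.

Lemma sliding_shift t i : Y (t + l)%N (i + k%:Z) = Y t i.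
Proof.
have n_gt0 : (0 < n)%N by lia.
have [q [j [-> jb]]] := window_rep (b t + k%:Z - n%:Z) i n_gt0.
rewrite addrAC !Yq; congr (_ + _).
have [jt|tj] := lerP j (b t).
  by rewrite !(sw_zero hY) ?sliding_pointer //; lia.
(* Both values are positive, so they are determined by their comparisons with all naturals, that is,
   by hitting times. *)
have hits s : (Y (t + l)%N (j + k%:Z) <= s%:Z) = (Y t j <= s%:Z).
  rewrite -!sliding_hit ?sliding_pointer; try lia.
  by rewrite addnAC sliding_pointer; lia.
have := sw_le0 hY t j; have := sw_le0 hY (t + l) (j + k%:Z).
rewrite sliding_pointer; move: (Y _ _) (Y _ _) hits => y y' hits.
by have := hits `|y|%N; have := hits `|y'|%N; lia.
Qed.

Lemma sliding_period t i q c : (q * k = c * n)%N ->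
  Y (t + q * l)%N i = Y t i - (c * l)%N%:Z.
Proof.
move=> qk.
have iter_shift m : Y (t + m * l)%N (i + (m * k)%N%:Z) = Y t i.
  elim: m => [|m IHm]; first by rewrite !mul0n addn0 addr0.
  have -> : (t + m.+1 * l = (t + m * l) + l)%N by rewrite mulSn; lia.
  have -> : i + (m.+1 * k)%N%:Z = i + (m * k)%N%:Z + k%:Z by rewrite mulSn; lia.
  by rewrite sliding_shift.
rewrite -(iter_shift q) qk PoszM Yq PoszM; lia.
Qed.

End Sliding.

(** * Bears as low ranks, and preservation of order *)

(** In the sorted list, the elements [j] with [r j i] form the prefix ending at [i]; their number is
    the position of [i] plus one. *)
Lemma mem_take_sort (T : finType) (r : rel T) (A : {set T}) (m : nat) (i : T) :
  total r -> transitive r -> antisymmetric r ->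
  (i \in take m (sort r (enum A)))
    = (i \in A) && (#|[set j in A | r j i]| <= m)%N.
Proof.
move=> r_total r_trans r_anti; set s := sort r (enum A).
have s_uniq : uniq s by rewrite sort_uniq enum_uniq.
have memsE j : (j \in s) = (j \in A) by rewrite mem_sort mem_enum.
have s_sorted : sorted r s by exact: sort_sorted.
have r_refl : reflexive r by move=> j; have := r_total j j; rewrite orbb.
have [iA|iA] /= := boolP (i \in A); last first.
  by apply: contraNF iA => /mem_take; rewrite memsE.
have is_ : i \in s by rewrite memsE.
rewrite in_take // -[(_ < m)%N]/((index i s).+1 <= m)%N; congr (_ <= _)%N.
have <- : size (take (index i s).+1 s) = (index i s).+1.
  by rewrite size_takel // index_mem.
rewrite -(card_uniqP (take_uniq _ s_uniq)).
apply: eq_card => j; rewrite !inE -memsE.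
have [js|js] /= := boolP (j \in s); last first.
  by apply: contraNF js => /mem_take.
rewrite in_take // ltnS; apply/idP/idP => [|ji].
  exact: sorted_leq_index.
rewrite leqNgt; apply: contraTN (ltnSn (index i s)) => ij.
have eij : i = j by apply: r_anti; rewrite ji (sorted_ltn_index r_trans s_sorted).
by move: ij; rewrite eij ltnn.
Qed.

Section BearOrder.

Context (n : nat) (x : n.-tuple int).

Lemma bear_order_total : total (bear_order x).
Proof. by move=> i j; rewrite /bear_order; lia. Qed.

Lemma bear_order_trans : transitive (bear_order x).
Proof. by move=> i j m; rewrite /bear_order; lia. Qed.

Lemma bear_order_anti : antisymmetric (bear_order x).
Proof. by move=> i j; rewrite /bear_order => ij; apply: val_inj => /=; lia. Qed.

Lemma bears_big (k l : nat) (i : 'I_n) : (n - k <= #|mult_set l x|)%N ->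
  (i \in bears k l x) = (i \in mult_set l x)
    && (#|[set j in mult_set l x | bear_order x j i]| <= n - k)%N.
Proof.
move=> big; rewrite /bears big inE mem_take_sort //.
- exact: bear_order_total.
- exact: bear_order_trans.
- exact: bear_order_anti.
Qed.

(** Both branches of [bears] prefer the right one of two equal entries: by the tie-breaking rule, or
    by listing non-multiples from the largest index down. *)
Lemma bears_right (k l : nat) (i j : 'I_n) : (i <= j)%N ->
  tnth x i = tnth x j -> i \in bears k l x -> j \in bears k l x.
Proof.
move=> ij xij; have Mij : (j \in mult_set l x) = (i \in mult_set l x).
  by rewrite !inE xij.
have [big|small] := leqP (n - k) #|mult_set l x|.
  rewrite !bears_big // Mij => /andP[-> /=]; apply: leq_trans.
  apply/subset_leq_card/subsetP => m; rewrite !inE => /andP[-> /=].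
  by rewrite /bear_order xij; lia.
rewrite /bears leqNgt small /= !in_setU Mij.
have [//|iM] /= := boolP (i \in mult_set l x).
set s := rev _; have ins m : m \notin mult_set l x -> m \in s.
  by rewrite mem_rev mem_enum !inE.
have s_sorted : sorted (fun a b : 'I_n => (b <= a)%N) s.
  rewrite rev_sorted {1}/enum_mem sorted_filter //; first exact: leq_trans.
  have := iota_sorted 0 n; rewrite -val_enum_ord sorted_map.
  by rewrite enumT.
rewrite !inE !in_take ?ins ?Mij //; apply: leq_ltn_trans.
rewrite leqNgt; apply/negP => ltij.
have : (j <= i)%N.
  apply: (sorted_ltn_index _ s_sorted) ltij; rewrite ?ins ?Mij //.
  by move=> a b c ba cb; exact: leq_trans cb ba.
move=> ji; have eij : i = j by apply: val_inj; apply/eqP; rewrite eqn_leq ij.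
by rewrite eij ltnn in ltij.
Qed.

End BearOrder.

(** A strict inequality of integers survives a decrease by 1. Equal neighbours could only be
    disordered by a bear left of a bull, which [bears_right] excludes. *)
Lemma GM_move_sorted (n k l : nat) (x : n.-tuple int) :
  sorted <=%R x -> sorted <=%R (GM_move k l x).
Proof.
move=> x_sorted.
have tnth_mono (i j : 'I_n) : (i <= j)%N -> tnth x i <= tnth x j.
  move=> ij; rewrite !(tnth_nth 0).
  by rewrite (sorted_leq_nth le_trans) ?inE ?size_tuple.
apply/(sortedP 0) => i; rewrite size_tuple => i1n.
have i0n := ltnW i1n.
rewrite -[i.+1]/(val (Ordinal i1n)) -{1}[i]/(val (Ordinal i0n)).
rewrite -!tnth_nth !tnth_mktuple.
have := @tnth_mono (Ordinal i0n) (Ordinal i1n) (leqnSn i).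
have := @bears_right n x k l (Ordinal i0n) (Ordinal i1n) (leqnSn i).
case: ifP => _; case: ifP => _ //; lia.
Qed.

Lemma card_injective_le (n : nat) (f : 'I_n -> 'I_n) (a : 'I_n) :
  injective f -> #|[set j | (f j <= a)%N]| = a.+1.
Proof.
move=> f_inj.
have -> : [set j | (f j <= a)%N] = f @^-1: [set j : 'I_n | (j < a.+1)%N].
  by apply/setP=> j; rewrite !inE.
rewrite card_preimset // -sum1dep_card.
by rewrite -(big_ord_widen _ (fun=> 1%N)) // sum1_card card_ord.
Qed.

Lemma mul_gap (n : nat) (p q : int) : p < q -> p * n%:Z + n%:Z <= q * n%:Z.
Proof. by move=> pq; rewrite -[X in _ + X]mul1r -mulrDl ler_wpM2r //; lia. Qed.

Lemma ord_lex (n : nat) (i j : 'I_n) (p q : int) :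
  (i%:Z + p * n%:Z <= j%:Z + q * n%:Z) = (p < q) || (p == q) && (i <= j)%N.
Proof.
have := ltn_ord i; have := ltn_ord j.
have := @mul_gap n p q; have := @mul_gap n q p.
by case: (ltgtP p q) => [pq|qp|->] /=; lia.
Qed.

(** * The extension of a state to all integer indices *)

(** Indices are 0-based. For [n > 0] the remainder is nonnegative, so the absolute value only casts
    it to [nat]. *)
Definition lift (n l : nat) (x : n.-tuple int) (i : int) : int :=
  x`_`|(i %% n%:Z)%Z| + (i %/ n%:Z)%Z * l%:Z.

Section Lift.

Context (n l : nat).
Hypothesis (n_gt0 : (0 < n)%N).

Lemma lift_ord (x : n.-tuple int) (i : 'I_n) (q : int) :
  lift l x (i%:Z + q * n%:Z) = tnth x i + q * l%:Z.
Proof.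
have nz : n%:Z != 0 by lia.
have i_lt : (0 <= i%:Z < `|n%:Z|) by have := ltn_ord i; lia.
rewrite [i%:Z + _]addrC /lift modzMDl divzMDl // divz_small // addr0.
by rewrite modz_small //= (tnth_nth 0).
Qed.

Lemma ord_rep (i : int) : exists (j : 'I_n) (q : int), i = j%:Z + q * n%:Z.
Proof.
have [q [j [-> jn]]] := window_rep (-1) i n_gt0.
have jlt : (`|j| < n)%N by lia.
by exists (Ordinal jlt), q; congr (_ + _) => /=; lia.
Qed.

Lemma lift_shift (x : n.-tuple int) (i : int) : lift l x (i + n%:Z) = lift l x i + l%:Z.
Proof.
have [j [q ->]] := ord_rep i.
have -> : j%:Z + q * n%:Z + n%:Z = j%:Z + (q + 1) * n%:Z.
  by rewrite mulrDl mul1r addrA.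
by rewrite !lift_ord mulrDl mul1r addrA.
Qed.

Lemma lift_cut (x : n.-tuple int) : (0 < l)%N ->
  exists b : int, (lift l x b <= 0) && (0 < lift l x (b + 1)).
Proof.
move=> l_gt0.
pose a : 'I_n := Ordinal n_gt0.
(* Going down [m] periods subtracts [m * l], at least the first entry; [2m + 1] periods up from
   there the value is positive. *)
pose m := `|tnth x a|%N; pose c : int := a%:Z + (- m%:Z) * n%:Z.
have c_le : lift l x c <= 0 by rewrite lift_ord /m; nia.
have up : exists s : nat, 0 < lift l x (c + s%:Z).
  exists ((m + m).+1 * n)%N.
  by rewrite PoszM (shift_mul _ _ (lift_shift x)) lift_ord /m; nia.
case: (ex_minnP up) => -[|s]; first by rewrite addr0; lia.
move=> s_gt s_min; exists (c + s%:Z); apply/andP; split.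
  by rewrite leNgt; apply/negP => /s_min; rewrite ltnn.
by rewrite -addrA -PoszD addn1.
Qed.

Context (x : n.-tuple int).
Hypotheses (x_sorted : sorted <=%R x) (x_range : range x <= l%:Z).

(** Inside a period this is sortedness of [x]; across a period boundary it is the bound on the
    range. *)
Lemma lift_mono (i j : int) : i <= j -> lift l x i <= lift l x j.
Proof.
have step m : lift l x m <= lift l x (m + 1).
  have [a [q ->]] := ord_rep m; rewrite lift_ord.
  have [an|na] := ltnP a.+1 n.
    have -> : a%:Z + q * n%:Z + 1 = (Ordinal an)%:Z + q * n%:Z by rewrite /=; lia.
    rewrite lift_ord lerD2r !(tnth_nth 0) /=.
    by apply: (sorted_leq_nth le_trans) => //; rewrite ?inE ?size_tuple.
  have -> : a%:Z + q * n%:Z + 1 = (Ordinal n_gt0)%:Z + (q + 1) * n%:Z.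
    by rewrite /= mulrDl; have := ltn_ord a; lia.
  rewrite lift_ord !(tnth_nth 0) /= mulrDl mul1r.
  have -> : nat_of_ord a = n.-1 by have := ltn_ord a; lia.
  by rewrite [q * _ + _]addrC addrA lerD2r addrC -lerBlDr.
move=> ij; have -> : j = i + `|j - i|%N%:Z by lia.
elim: `|j - i|%N => [|m IHm]; first by rewrite addr0.
by rewrite -addn1 PoszD addrA (le_trans IHm).
Qed.

Hypothesis (l_gt0 : (0 < l)%N).
Context (k : nat) (b : int).
Hypothesis (hb : forall i, (lift l x i <= 0) = (i <= b)).
Hypothesis (big : (n - k <= #|mult_set l x|)%N).

(** On the period ending at [b] the values lie in [(-l, 0]], so the multiples of [l] are the zeros,
    a final segment by monotonicity. The bear order reads it from [b] downwards. *)
Lemma bears_window (i : 'I_n) (q : int) : (0 < k < n)%N ->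
  b - n%:Z < i%:Z + q * n%:Z <= b ->
  [/\ (i \in bears k l x) = (b + k%:Z - n%:Z < i%:Z + q * n%:Z) &
      b + k%:Z - n%:Z < i%:Z + q * n%:Z -> lift l x (i%:Z + q * n%:Z) = 0].
Proof.
move=> hk hi.
(* [d j] is the cyclic distance from [j] up to [b]: the bear order on the
   multiples of [l] is the order of these distances. *)
have rep (j : 'I_n) : exists d : 'I_n, exists p : int, j%:Z + p * n%:Z = b - d%:Z.
  have [d [p e]] := ord_rep (b - j%:Z).
  by exists d, p; lia.
have [d dP] := fin_all_exists rep; have [p pP] := fin_all_exists dP.
have Mz j : (j \in mult_set l x) = (lift l x (b - (d j)%:Z) == 0).
  have ub : lift l x (b - (d j)%:Z) <= 0 by rewrite hb; lia.
  have lb : 0 < lift l x (b - (d j)%:Z) + l%:Z.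
    by rewrite -lift_shift ltNge hb; have := ltn_ord (d j); lia.
  move: ub lb; rewrite -pP lift_ord inE => ub lb.
  apply/dvdzP/eqP => [[c e]|e]; last by exists (- p j); lia.
  have l_pos : 0 < l%:Z by [].
  have {lb} : 0 < (c + p j + 1) * l%:Z by rewrite !mulrDl mul1r -e.
  move: ub; rewrite e -mulrDl pmulr_lgt0 // pmulr_lle0 // => ub lb.
  by have -> : c + p j = 0 by [lia]; rewrite mul0r.
have d_inj : injective d.
  move=> u v e; have := pP u; have := pP v; rewrite e => ev eu.
  have : u%:Z + p u * n%:Z <= v%:Z + p v * n%:Z by rewrite eu ev.
  have : v%:Z + p v * n%:Z <= u%:Z + p u * n%:Z by rewrite eu ev.
  by rewrite !ord_lex => vu uv; apply: val_inj => /=; lia.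
(* A zero of the lift in period [p] has entry [-p * l]: smaller entries lie in later periods, and
   ties go to the right, so the bear order is the reversed order of positions. *)
have ord_d u v : u \in mult_set l x -> v \in mult_set l x ->
    bear_order x u v = (d u <= d v)%N.
  rewrite !Mz -!pP !lift_ord => /eqP/addr0_eq eu /eqP/addr0_eq ev.
  have -> : (d u <= d v)%N = (v%:Z + p v * n%:Z <= u%:Z + p u * n%:Z).
    by rewrite !pP; lia.
  rewrite ord_lex /bear_order -[tnth x u]opprK -[tnth x v]opprK.
  rewrite eu ev ltrN2 eqr_opp.
  have l_pos : 0 < l%:Z by [].
  by rewrite ltr_pM2r // (inj_eq (mulIf (lt0r_neq0 l_pos))) [p u == _]eq_sym.
have M_down u v : (d u <= d v)%N -> v \in mult_set l x -> u \in mult_set l x.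
  rewrite !Mz => uv /eqP ev; rewrite eq_le hb -ev lift_mono; lia.
(* Both sides are congruent to [i] modulo [n] and lie in the same window of length [n]. *)
have -> : i%:Z + q * n%:Z = b - (d i)%:Z.
  have := pP i; have := ltn_ord (d i); have := @mul_gap n q (p i).
  by have := @mul_gap n (p i) q; case: (ltgtP q (p i)) => [| |->] //; lia.
(* If [i] were no multiple, all multiples would be strictly closer to [b], hence at most
   [d i < n - k] in number. *)
have M_small : (d i < n - k)%N -> i \in mult_set l x.
  move=> di; apply: contraTT big => iM; rewrite -ltnNge.
  apply: leq_ltn_trans di; rewrite -ltnS -(card_injective_le (d i) d_inj).
  apply/proper_card/properP; split.
    apply/subsetP => j jM; rewrite inE; apply: contraNT iM; rewrite -ltnNge.
    by move=> /ltnW /M_down; apply.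
  by exists i => //; rewrite inE.
split; last first.
  by move=> di; apply/eqP; rewrite -Mz M_small //; lia.
rewrite bears_big //; have [iM|iM] /= := boolP (i \in _); last first.
  by apply/esym/negbTE; apply: contraNN iM => di; apply: M_small; lia.
have -> : [set j in mult_set l x | bear_order x j i] = [set j | (d j <= d i)%N].
  apply/setP => j; rewrite !inE; apply/andP/idP => [[jM]|dj].
    by rewrite ord_d // inE.
  have jM := M_down _ _ dj iM; rewrite ord_d // dj.
  by move: jM; rewrite inE.
rewrite card_injective_le //; lia.
Qed.

Lemma lift_zero (i : int) : (0 < k < n)%N ->
  b + k%:Z - n%:Z < i <= b -> lift l x i = 0.
Proof.
move=> hk; have [j [q ->]] := ord_rep i => jb.
by have [|_ ->] := @bears_window j q hk; lia.
Qed.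

Lemma lift_move (i : int) : (0 < k < n)%N -> b - n%:Z < i <= b ->
  lift l (GM_move k l x) i =
    if b + k%:Z - n%:Z < i then lift l x i else lift l x i - 1.
Proof.
move=> hk; have [j [q ->]] := ord_rep i => jb.
rewrite !lift_ord /GM_move tnth_mktuple; have [-> _] := bears_window hk jb.
by case: ifP => // _; rewrite addrAC.
Qed.

End Lift.

(** * The GM sequence as a sliding window, and the theorem *)

Lemma GM_seq_sorted (n k l : nat) (x : n.-tuple int) (j : nat) :
  sorted <=%R x -> sorted <=%R (GM_seq k l x j).
Proof. by move=> x_sorted; elim: j => // j; exact: GM_move_sorted. Qed.

Lemma GM_sliding (n k l N : nat) (x0 : n.-tuple int) :
  (0 < k < n)%N -> (0 < l)%N -> sorted <=%R x0 ->
  (forall j : nat, (N <= j)%N ->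
     (n - k <= #|mult_set l (GM_seq k l x0 j)|)%N /\
     range (GM_seq k l x0 j) <= l%:Z) ->
  exists b, sliding_window n k l (fun t => lift l (GM_seq k l x0 (N + t))) b.
Proof.
move=> hk l_gt0 x0_sorted good; have n_gt0 : (0 < n)%N by lia.
pose X t := GM_seq k l x0 (N + t).
have X_big t : (n - k <= #|mult_set l (X t)|)%N by have [] := good _ (leq_addr t N).
have X_range t : range (X t) <= l%:Z by have [] := good _ (leq_addr t N).
have X_sorted t : sorted <=%R (X t) by exact: GM_seq_sorted.
have XS t : X t.+1 = GM_move k l (X t) by rewrite /X addnS.
have cut t := lift_cut n_gt0 (X t) l_gt0.
pose b t := xchoose (cut t).
(* Monotonicity makes the chosen sign change the only one. *)
have le0 t i : (lift l (X t) i <= 0) = (i <= b t).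
  have /andP[b_le b_gt] := xchooseP (cut t).
  have mono := lift_mono n_gt0 (X_sorted t) (X_range t).
  apply/idP/idP => [|ib]; last exact: le_trans (mono _ _ ib) b_le.
  apply: contraTT; rewrite -!ltNge => bi.
  by apply: (lt_le_trans b_gt); apply: mono; rewrite lezD1.
have move t i := lift_move n_gt0 (X_sorted t) (X_range t) l_gt0 (le0 t)
  (X_big t) (i := i) hk.
suff: sliding_window n k l (fun t => lift l (X t)) b by exists b.
split=> /=.
- by move=> t i; exact: lift_shift.
- exact: le0.
- by move=> t i; exact: (lift_zero n_gt0 (X_sorted t) (X_range t) l_gt0).
(* [lift_move] describes the period ending at [b t], while bulls and bears are here taken just after
   [b t]; hence the shift down by [n]. *)
- move=> t i ib; rewrite XS -[i](subrK n%:Z) !lift_shift // move; last by lia.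
  by rewrite ifF; lia.
- move=> t i ib; rewrite XS -[i](subrK n%:Z) !lift_shift // move; last by lia.
  by rewrite ifT; lia.
Qed.

Theorem theorem1 (n k l : nat) (x0 : n.-tuple int) (N : nat)
    (hk : (0 < k < n)%N) (hl : (1 < l)%N) (hx0 : sorted <=%R x0)
    (hN : forall j : nat,
        ((n - k <= #|mult_set l (GM_seq k l x0 j)|)%N /\
         range (GM_seq k l x0 j) <= l%:Z) <-> (N <= j)%N) :
  period n k l = ((l * lcmn n k) %/ k)%N /\
  forall (i : 'I_n) (j : nat), (N <= j)%N ->
    tnth (GM_seq k l x0 j) i - tnth (GM_seq k l x0 (j + period n k l)) i
      = (drop_value n k l)%:Z.
Proof.
have /andP[k_gt0 k_lt] := hk; have n_gt0 := ltn_trans k_gt0 k_lt.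
set g := gcdn n k; have g_gt0 : (0 < g)%N by rewrite gcdn_gt0 n_gt0.
have pE : period n k l = (n %/ g * l)%N.
  by rewrite /period -muln_divA ?dvdn_gcdl // mulnC.
(* [n / g] blocks of [l] steps shift the indices by [k / g] full periods, each worth [l]. *)
have qk : (n %/ g * k = k %/ g * n)%N.
  by rewrite divn_mulAC ?dvdn_gcdl // mulnC divn_mulAC ?dvdn_gcdr.
have dE : drop_value n k l = (k %/ g * l)%N.
  by rewrite /drop_value pE mulnAC qk mulnAC mulnK.
split=> [|i j Nj].
  have -> : lcmn n k = (n %/ g * k)%N by rewrite divn_mulAC ?dvdn_gcdl.
  by rewrite pE mulnA mulnK // mulnC.
have [b slides] := GM_sliding hk (ltnW hl) hx0 (fun j => (hN j).2).
have := sliding_period hk (ltnW hl) slides (j - N) i%:Z qk.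
rewrite addnA subnKC // -pE -dE.
have liftE (x : n.-tuple int) : lift l x i%:Z = tnth x i.
  by have := lift_ord l n_gt0 x i 0; rewrite !mul0r !addr0.
by rewrite !liftE => ->; rewrite subKr.
Qed.
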